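(* Let $M_g$ be a generator $\epsilon$-machine and let $\mathcal{P}=(\mathcal{X}^{\mathbb{Z}},\mathbb{X},\mathbb{P})$ be the process generated by $M_g$. Then $\mathcal{P}$ is finitely characterized, and the history $\epsilon$-machine $M_h(\mathcal{P})$ is isomorphic to $M_g$ as a hidden Markov model.
   Context: Processes. For a finite alphabet $\mathcal{X}$, $\mathcal{X}^*$ is the set of words over $\mathcal{X}$ of finite positive length; $|w|$ is the length of $w$. A process over $\mathcal{X}$ is a probability space $(\mathcal{X}^{\mathbb{Z}},\mathbb{X},\mathbb{P})$, where $\mathbb{X}$ is generated by the cylinders $A_{w,t}=\{(x_s)_{s\in\mathbb{Z}}: x_t\cdots x_{t+|w|-1}=w\}$. It is stationary if $\mathbb{P}$ is shift invariant, and ergodic if every shift-invariant event has probability $0$ or $1$. For stationary processes $\mathbb{P}(w):=\mathbb{P}(A_{w,t})$ (any $t$), and $\mathbb{P}(w|v):=\mathbb{P}(vw)/\mathbb{P}(v)$ if $\mathbb{P}(v)>0$. A stationary process is determined by its word probabilities $\mathbb{P}(w)$. Hidden Markov models. An (edge-emitting) HMM is a triple $(\mathcal{S},\mathcal{X},\{T^{(x)}\}_{x\in\mathcal{X}})$ with $\mathcal{S}=\{\sigma_1,\dots,\sigma_N\}$ a finite set of states, $\mathcal{X}$ a finite alphabet, and $T^{(x)}$ nonnegative $N\times N$ matrices such that $T=\sum_x T^{(x)}$ is stochastic (rows sum to 1). $T^{(x)}_{ij}$ is the probability of moving from $\sigma_i$ to $\sigma_j$ while emitting $x$. The associated directed graph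 has vertices $\mathcal{S}$ and an edge $\sigma_i\to\sigma_j$ labeled by symbol $x$ and probability $T^{(x)}_{ij}$ whenever $T^{(x)}_{ij}>0$. For $w=w_0\cdots w_{l-1}$, $T^{(w)}=T^{(w_0)}\cdots T^{(w_{l-1})}$, and $\mathbf{P}_{\sigma_i}(w)=\|e_iT^{(w)}\|_1$ ($e_i$ the $i$th standard basis row vector). Two HMMs are isomorphic if there is a bijection between their state sets preserving edges, including the symbols and probabilities labeling the edges. If the graph is strongly connected, $T$ has a unique stationary distribution $\pi=\pi T$, and the process generated by the HMM is the stationary ergodic process with $\mathbb{P}(w)=\|\pi T^{(w)}\|_1$ for all $w\in\mathcal{X}^*$. Generator $\epsilon$-machine. An HMM such that: (1) its graph is strongly connected; (2) (unifilarity) for each state $\sigma_i$ and symbol $x$ there is at most one outgoing edge from $\sigma_i$ labeled with $x$; (3) (probabilistically distinct states) for each pair of distinct states $\sigma_i,\sigma_j$ there is $w\in\mathcal{X}^*$ with $\mathbf{P}_{\sigma_i}(w)\neq\mathbf{P}_{\sigma_j}(w)$. History $\epsilon$-machine. Let $\mathcal{P}$ be a stationary ergodic process over a finite alphabet $\mathcal{X}$. Let $\mathcal{X}^-$ be the set of pasts $\overleftarrow{x}=\dots x_{-2}x_{-1}$, with the cylinder $\sigma$-algebra $\mathbb{X}^-$ and the projected measure $\mathbb{P}^-$. Write $\overleftarrow{x}^t=x_{-t}\cdots x_{-1}$. A past is regular if $\mathbb{P}(\overleftarrow{x}^t)>0$ for all $t$ and $\mathbf{P}(w|\overleftarrow{x}):=\lim_{t\to\infty}\mathbb{P}(w|\overleftarrow{x}^t)$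 exists for every $w\in\mathcal{X}^*$. On regular pasts put $\overleftarrow{x}\sim\overleftarrow{x}'$ iff $\mathbf{P}(w|\overleftarrow{x})=\mathbf{P}(w|\overleftarrow{x}')$ for all $w\in\mathcal{X}^*$; let $\mathcal{E}$ be the set of equivalence classes, and for $E\in\mathcal{E}$ let $\mathbf{P}(w|E)=\mathbf{P}(w|\overleftarrow{x})$ for any $\overleftarrow{x}\in E$, and $\mathbb{P}(E)=\mathbb{P}^-(E)$ (classes are measurable). For $x\in\mathcal{X}$ with $\mathbf{P}(x|E)>0$, $\delta_h(E,x)$ is the class containing $\overleftarrow{x}x$ (the past $\overleftarrow{x}$ with symbol $x$ appended) for $\overleftarrow{x}\in E$; this is well defined. $\mathcal{P}$ is finitely characterized if there are finitely many classes $E_1,\dots,E_N$ with $\mathbb{P}(E_i)>0$ and $\sum_i\mathbb{P}(E_i)=1$; then $\mathcal{E}^+=\{E_1,\dots,E_N\}$. In that case $M_h(\mathcal{P})=(\mathcal{E}^+,\mathcal{X},\{T^{(x)}\})$ with $T^{(x)}_{ij}=\mathbf{P}(x|E_i)$ if $\mathbf{P}(x|E_i)>0$ and $\delta_h(E_i,x)=E_j$, and $T^{(x)}_{ij}=0$ otherwise. *)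

(* Defs.v *)
From HB Require Import structures.
From mathcomp Require Import all_boot all_order all_algebra.
From mathcomp Require Import all_classical all_reals all_analysis.
Set Implicit Arguments.
Unset Strict Implicit.
Unset Printing Implicit Defensive.
Import Order.TTheory GRing.Theory Num.Theory.
Import numFieldNormedType.Exports.
Local Open Scope classical_set_scope.
Local Open Scope ring_scope.

(* Measurable types must be pointed, so an alphabet is a nonempty finite type;
   over an empty alphabet there is no process.                               *)
#[short(type="alphabetType")]
HB.structure Definition Alphabet := {X of Finite X & isPointed X}.

Definition cylinder (X : Type) (w : seq X) (t : int) : set (int -> X) :=
  [set x | mkseq (fun k => x (t + k%:Z)) (size w) = w].

Definition cylinders (X : Type) : set (set (int -> X)) :=
  [set A | exists w t, w <> [::] /\ A = cylinder w t].

Definition biseq (X : alphabetType) := g_sigma_algebraType (@cylinders X).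

Definition bishift (X : Type) (x : int -> X) : int -> X := fun t => x (t + 1).

Section Processes.
Context (R : realType) (X : alphabetType) (P : probability (biseq X) R).
Local Open Scope ereal_scope.

Definition stationary_process :=
  forall A : set (biseq X), measurable A -> P (@bishift X @^-1` A) = P A.

Definition ergodic_process :=
  forall A : set (biseq X), measurable A -> @bishift X @^-1` A = A ->
    P A = 0 \/ P A = 1.

Definition word_prob (w : seq X) : R := fine (P (cylinder w 0)).

Definition cond_prob (w v : seq X) : R :=
  (word_prob (v ++ w) / word_prob v)%R.

End Processes.

(* The data of a hidden Markov model with states indexed by 'I_nstates;
   see [is_hmm] for the conditions on the matrices.                        *)
Record hmm (R : realType) (X : finType) := HMM {
  nstates : nat;
  trans : X -> 'M[R]_nstates }.

Section HiddenMarkovModels.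
Context (R : realType) (X : finType).
Implicit Type M : hmm R X.

Definition l1norm n (v : 'rV[R]_n) : R := \sum_j `|v 0 j|.

Definition total_mx M : 'M[R]_(nstates M) := \sum_x trans M x.

Definition is_hmm M :=
  (forall x i j, 0 <= trans M x i j) /\
  (forall i, \sum_j total_mx M i j = 1).

Definition edge M (i : 'I_(nstates M)) (x : X) (p : R) (j : 'I_(nstates M)) :=
  0 < p /\ trans M x i j = p.

Definition hmm_isomorphic M1 M2 :=
  exists2 f : 'I_(nstates M1) -> 'I_(nstates M2), bijective f &
    forall i x p j, edge i x p j <-> edge (f i) x p (f j).

Definition word_mx M (w : seq X) : 'M[R]_(nstates M) :=
  \big[mulmx/1%:M]_(x <- w) trans M x.

Definition state_prob M (i : 'I_(nstates M)) (w : seq X) : R :=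
  l1norm (delta_mx 0 i *m word_mx M w).

Definition strongly_connected M :=
  forall i j : 'I_(nstates M),
    connect [rel k l | [exists x, 0 < trans M x k l]] i j.

Definition unifilar M :=
  forall (i : 'I_(nstates M)) x j k p q,
    edge i x p j -> edge i x q k -> j = k.

Definition distinct_states M :=
  forall i j : 'I_(nstates M), i != j ->
    exists2 w, w != [::] & state_prob i w != state_prob j w.

Definition generator_eps_machine M :=
  [/\ is_hmm M, strongly_connected M, unifilar M & distinct_states M].

Definition stationary_distribution M (pi : 'rV[R]_(nstates M)) :=
  [/\ forall i, 0 <= pi 0 i, \sum_i pi 0 i = 1 & pi *m total_mx M = pi].

End HiddenMarkovModels.

Definition generated_process (R : realType) (X : alphabetType) (M : hmm R X)
    (P : probability (biseq X) R) :=
  [/\ stationary_process P, ergodic_process P &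
    exists2 pi, stationary_distribution pi &
      forall w, w != [::] -> word_prob P w = l1norm (pi *m word_mx M w)].

(* A past p lists the symbols backwards in time: p n is x_(-(n+1)). *)
Definition past_word (X : Type) (p : nat -> X) (t : nat) : seq X :=
  rev (mkseq p t).

Definition past_cylinders (X : Type) : set (set (nat -> X)) :=
  [set A | exists w, w <> [::] /\ A = [set p | past_word p (size w) = w]].

Definition past (X : alphabetType) := g_sigma_algebraType (@past_cylinders X).

Definition past_of (X : alphabetType) (x : biseq X) : past X :=
  fun n => x (- (n.+1)%:Z).

Lemma past_word_past_of (X : alphabetType) (x : biseq X) (t : nat) :
  past_word (past_of x) t = mkseq (fun k => x (- t%:Z + k%:Z)) t.
Proof.
apply: (@eq_from_nth _ point); rewrite /past_word size_rev !size_mkseq // => i it.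
rewrite nth_rev size_mkseq // !nth_mkseq //; last first.
  by rewrite ltn_subrL; case: (t) it.
by rewrite /past_of -subSn // subSS -subzn ?opprB 1?addrC // ltnW.
Qed.

Lemma measurable_past_of (X : alphabetType) :
  measurable_fun [set: biseq X] (@past_of X).
Proof.
apply: (@measurability _ _ (biseq X) (past X) _ _ (@past_cylinders X)) => //.
move=> _ [_ [w [w0 ->]] <-]; rewrite setTI.
apply: sub_sigma_algebra; exists w, (- (size w)%:Z); split=> //.
by apply/seteqP; split=> x /=; rewrite past_word_past_of.
Qed.

HB.instance Definition _ (X : alphabetType) :=
  isMeasurableFun.Build _ _ (biseq X) (past X) (@past_of X)
    (@measurable_past_of X).

Definition past_cons (X : alphabetType) (p : past X) (x : X) : past X :=
  fun n => if n is m.+1 then p m else x.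

Section HistoryMachine.
Context (R : realType) (X : alphabetType) (P : probability (biseq X) R).
Implicit Types (p q : past X) (E F : set (past X)) (w : seq X) (x : X).

Definition past_law : probability (past X) R := distribution P (@past_of X).

Definition regular_past p :=
  (forall t, 0 < word_prob P (past_word p t)) /\
  (forall w, w != [::] -> cvgn (fun t => cond_prob P w (past_word p t))).

Definition past_prob w p : R :=
  limn (fun t => cond_prob P w (past_word p t)).

Definition past_equiv p q :=
  forall w, w != [::] -> past_prob w p = past_prob w q.

Definition eps_classes : set (set (past X)) :=
  [set [set q | regular_past q /\ past_equiv p q] | p in regular_past].

(* The common value of [past_prob w] on the class E. *)
Definition class_prob w E : R := get (past_prob w @` E).

(* The class containing all the past_cons p x for p in E; it exists and is
   unique when E is a class with 0 < class_prob [:: x] E.                  *)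
Definition delta_h E x : set (past X) :=
  get [set F | eps_classes F /\ forall p, E p -> F (past_cons p x)].

(* E enumerates, without repetition, the classes of positive probability, and
   they carry all the mass.                                                   *)
Definition positive_classes N (E : 'I_N -> set (past X)) :=
  [/\ injective E,
      forall i, eps_classes (E i),
      forall i, (0 < past_law (E i))%E &
      (\sum_(i < N) past_law (E i))%E = 1%E].

Definition finitely_characterized :=
  exists N (E : 'I_N -> set (past X)), positive_classes E.

Definition history_machine N (E : 'I_N -> set (past X)) : hmm R X :=
  HMM (fun x => \matrix_(i, j)
    if (0 < class_prob [:: x] (E i)) && `[< delta_h (E i) x = E j >]
    then class_prob [:: x] (E i) else 0).

End HistoryMachine.

(* Main.v *)
Require Import Defs.
From mathcomp Require Import all_boot all_order all_algebra.
From mathcomp Require Import all_classical all_reals all_analysis.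
From mathcomp Require Import measurable_realfun ring lra zify.
Set Implicit Arguments.
Unset Strict Implicit.
Unset Printing Implicit Defensive.
Import Order.TTheory GRing.Theory Num.Theory.
Import numFieldNormedType.Exports.
Local Open Scope classical_set_scope.
Local Open Scope ring_scope.

(** Write T(w) for the matrix of a word w and phi_w for the filter pi T(w) / P(w),
  the conditional law of the state just reached given that w has just been
  emitted. The heart of the matter is that for almost every past p the laws
  phi_(p^t) converge to a point mass at some state k. Then the predictions
  P(v | p^t), which are the averages over k, with weights phi_(p^t)(k), of the
  P_k(v), converge to P_k(v), so that p is regular and lies in the class of the
  state k.

  Convergence follows from summable error bounds, without martingale theory. For
  states i and j let overlap t i j be the sum over the words w of length t, and
  over distinct endpoints k and l, of sqrt (T(w)_ik T(w)_jl). By unifilarity this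
  quantity vanishes for i = j and is submultiplicative in t ([overlap_cat]), and
  it is at most the Bhattacharyya coefficient of the laws that i and j induce on
  words of length t. The latter is below 1 as soon as t is large enough to tell
  i and j apart, so the overlaps decay geometrically and have a finite sum
  ([overlap_summable]). They control the expected uncertainty, that is, the mean
  of the sum over k of phi(k) (1 - phi(k)), at time t ([sum_uncertainty_le]);
  and since phi is a martingale along the past, the mean of
  |phi_(p^(t+1))(k) - phi_(p^t)(k)| is in turn at most twice the mean of
  phi_(p^t)(k) (1 - phi_(p^t)(k)) ([expected_drift_le]). By monotone convergence,
  almost surely both have finite sums over t. Finite variation makes phi_(p^t)
  converge and vanishing uncertainty makes the limit a point mass
  ([belief_cvg]).

  By dominated convergence the class of k has probability pi(k)
  ([measure_state_class]), which is positive by strong connectedness. Hence the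
  classes of the states are exactly the classes of positive probability
  ([positive_state_classes], [positive_classes_states]). Appending x to a past in
  the class of k conditions its predictions on x, and by unifilarity this turns
  P_k into P_l for the only l reached from k by emitting x; the matrix entries of
  the two machines therefore coincide ([history_machine_trans]). *)

(** * Sums over words and square roots of sums *)

Section WordSums.
Context (X : finType) (V : nmodType).
Implicit Type F : seq X -> V.

Lemma sum_words0 F : \sum_(w : 0.-tuple X) F w = F [::].
Proof.
rewrite (bigD1 [tuple]) //= big1 ?addr0 // => w /negP[].
by apply/eqP; apply: tuple0.
Qed.

Lemma sum_words_cons t F :
  \sum_(w : t.+1.-tuple X) F w = \sum_x \sum_(w : t.-tuple X) F (x :: w).
Proof.
rewrite pair_bigA /=.
rewrite (reindex (fun p : (X * t.-tuple X)%type => [tuple of p.1 :: p.2])) //=.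
exists (fun w : t.+1.-tuple X => (thead w, [tuple of behead w])) => [[x w] _ | w _] /=.
  by congr pair; apply: val_inj.
by rewrite -tuple_eta.
Qed.

Lemma sum_words_cat s t F :
  \sum_(w : (s + t).-tuple X) F w =
  \sum_(v : s.-tuple X) \sum_(w : t.-tuple X) F (v ++ w).
Proof.
elim: s F => [|s IHs] F.
  by rewrite (sum_words0 (fun v => \sum_(w : t.-tuple X) F (v ++ w))).
rewrite (sum_words_cons s (fun v => \sum_(w : t.-tuple X) F (v ++ w))).
rewrite [LHS](sum_words_cons (s + t)); apply: eq_bigr => x _.
exact: (IHs (fun w => F (x :: w))).
Qed.

End WordSums.

Section Sums.
Context (R : realType) (I : finType).
Implicit Type F : I -> R.

(** A row of a unifilar word matrix has this shape, which is what lets the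
  square root commute with its sum. *)
Lemma sqrt_sum_single F :
  (forall k l, F k != 0 -> F l != 0 -> k = l) ->
  \sum_k Num.sqrt (F k) = Num.sqrt (\sum_k F k).
Proof.
move=> F1; case: (pickP (fun k => F k != 0)) => [k Fk | F0].
  have F0 l : l != k -> F l = 0.
    by move=> lk; apply/eqP; apply: contraNT lk => Fl; apply/eqP/F1.
  rewrite (bigD1 k) //= big1 => [|l /F0 ->]; last by rewrite sqrtr0.
  by rewrite [in RHS](bigD1 k) //= [in RHS]big1 // !addr0.
have {}F0 k : F k = 0 by apply/eqP; have /negbFE := F0 k.
rewrite big1 => [|k _]; last by rewrite F0 sqrtr0.
by rewrite big1 ?sqrtr0.
Qed.

Lemma sqrt_sum_le F :
  (forall k, 0 <= F k) -> Num.sqrt (\sum_k F k) <= \sum_k Num.sqrt (F k).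
Proof.
move=> F0; rewrite -[leRHS]ger0_norm ?sumr_ge0 // -sqrtr_sqr ler_wsqrtr //.
rewrite expr2 mulr_suml; apply: ler_sum => k _.
rewrite -{1}(sqr_sqrtr (F0 k)) expr2 ler_wpM2l //.
by rewrite (bigD1 k) //= lerDl sumr_ge0.
Qed.

End Sums.

(** * Word matrices and state probabilities *)

Section HMM.
Context (R : realType) (X : finType) (M : hmm R X).
Hypothesis hmmM : is_hmm M.
Implicit Types (i j k l : 'I_(nstates M)) (v w : seq X).

Lemma word_mx_nil : word_mx M [::] = 1%:M.
Proof. by rewrite /word_mx big_nil. Qed.

Lemma word_mx_cons x w : word_mx M (x :: w) = trans M x *m word_mx M w.
Proof. by rewrite /word_mx big_cons. Qed.

Lemma word_mx_seq1 x : word_mx M [:: x] = trans M x.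
Proof. by rewrite word_mx_cons word_mx_nil mulmx1. Qed.

Lemma word_mx_cat v w : word_mx M (v ++ w) = word_mx M v *m word_mx M w.
Proof.
elim: v => [|x v IHv] /=; first by rewrite word_mx_nil mul1mx.
by rewrite !word_mx_cons IHv mulmxA.
Qed.

Lemma word_mx_ge0 w i k : 0 <= word_mx M w i k.
Proof.
elim: w i k => [|x w IHw] i k.
  by rewrite word_mx_nil mxE ler0n.
rewrite word_mx_cons mxE; apply: sumr_ge0 => l _.
by rewrite mulr_ge0 //; case: hmmM.
Qed.

Lemma state_probE i w : state_prob i w = \sum_k word_mx M w i k.
Proof.
rewrite /state_prob /l1norm -rowE; apply: eq_bigr => k _.
by rewrite mxE ger0_norm ?word_mx_ge0.
Qed.

Lemma state_prob_ge0 i w : 0 <= state_prob i w.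
Proof. by rewrite state_probE sumr_ge0 // => k _; apply: word_mx_ge0. Qed.

Lemma state_prob_cat i v w :
  state_prob i (v ++ w) = \sum_k word_mx M v i k * state_prob k w.
Proof.
rewrite state_probE word_mx_cat.
under eq_bigr do rewrite mxE.
by rewrite exchange_big /=; apply: eq_bigr => k _; rewrite state_probE mulr_sumr.
Qed.

Lemma sum_state_prob t i : \sum_(w : t.-tuple X) state_prob i w = 1.
Proof.
elim: t i => [|t IHt] i.
  rewrite (sum_words0 (state_prob i)) state_probE word_mx_nil.
  rewrite (bigD1 i) //= big1 => [|k ki]; first by rewrite mxE eqxx addr0.
  by rewrite mxE eq_sym (negPf ki).
rewrite (sum_words_cons t (state_prob i)).
under eq_bigr => x _ do under eq_bigr => w _ do
  rewrite -cat1s state_prob_cat word_mx_seq1.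
under eq_bigr => x _ do rewrite exchange_big /=.
under eq_bigr => x _ do under eq_bigr => k _ do rewrite -mulr_sumr IHt mulr1.
rewrite exchange_big /= -[RHS](proj2 hmmM i); apply: eq_bigr => k _.
by rewrite /total_mx summxE.
Qed.

(** The law of the longer words determines that of their prefixes; hence all pairs
  of distinct states can be told apart at one common word length. *)
Lemma eq_state_prob_shorter s t i j :
  (forall w : (s + t).-tuple X, state_prob i w = state_prob j w) ->
  forall v : s.-tuple X, state_prob i v = state_prob j v.
Proof.
have E k (v : s.-tuple X) :
    state_prob k v = \sum_(w : t.-tuple X) state_prob k (v ++ w).
  under eq_bigr do rewrite state_prob_cat.
  rewrite exchange_big /= state_probE; apply: eq_bigr => l _.
  by rewrite -mulr_sumr sum_state_prob mulr1.
move=> ij v; rewrite !E; apply: eq_bigr => w _.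
exact: (ij [tuple of v ++ w]).
Qed.

(** * Geometric decay of the overlap *)

Section Unifilar.
Hypothesis uniM : unifilar M.

Lemma trans_unifilar x i k l :
  trans M x i k != 0 -> trans M x i l != 0 -> k = l.
Proof.
have pos j : trans M x i j != 0 -> 0 < trans M x i j.
  by move=> ?; rewrite lt0r; apply/andP; split=> //; case: hmmM.
by move=> /pos Tk /pos Tl; apply: (uniM (conj Tk erefl) (conj Tl erefl)).
Qed.

Lemma word_mx_unifilar w i k l :
  word_mx M w i k != 0 -> word_mx M w i l != 0 -> k = l.
Proof.
elim: w i k l => [|x w IHw] i k l.
  rewrite word_mx_nil !mxE.
  case: (eqVneq i k) => [<-|_]; last by rewrite eqxx.
  by case: (eqVneq i l) => [<-|_]; last by rewrite eqxx.
have step j : word_mx M (x :: w) i j != 0 ->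
    exists a, trans M x i a != 0 /\ word_mx M w a j != 0.
  rewrite word_mx_cons mxE; apply: contraNP => /forallNP no.
  rewrite big1 // => a _; apply/eqP; rewrite mulf_eq0.
  by apply/negPn; rewrite negb_or; apply/negP => /andP; apply: no.
move=> /step[a [ia ak]] /step[b [ib bl]].
by move: bl; rewrite -(trans_unifilar ia ib); apply: IHw.
Qed.

(** The mass on which the words of length t emitted from i and from j look alike
  while still leading to distinct states, in the geometric mean of the two laws. *)
Definition overlap t i j : R :=
  \sum_(w : t.-tuple X) \sum_k \sum_(l | l != k)
    Num.sqrt (word_mx M w i k) * Num.sqrt (word_mx M w j l).

Lemma overlap_ge0 t i j : 0 <= overlap t i j.
Proof. by do 3!apply: sumr_ge0 => ? _; rewrite mulr_ge0. Qed.

Lemma overlap_diag t i : overlap t i i = 0.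
Proof.
rewrite /overlap big1 // => w _; rewrite big1 // => k _; rewrite big1 // => l lk.
case: (eqVneq (word_mx M w i k) 0) => [->|ik]; first by rewrite sqrtr0 mul0r.
case: (eqVneq (word_mx M w i l) 0) => [->|il]; first by rewrite sqrtr0 mulr0.
by rewrite (word_mx_unifilar il ik) eqxx in lk.
Qed.

(** Two runs that end in distinct states were in distinct states at every earlier
  time, so the overlap of length s + t factors through the pair of states reached
  after s symbols. *)
Lemma overlap_cat s t i j :
  overlap (s + t) i j <= \sum_(v : s.-tuple X) \sum_a \sum_b
    Num.sqrt (word_mx M v i a) * Num.sqrt (word_mx M v j b) * overlap t a b.
Proof.
rewrite /overlap (sum_words_cat s t (fun w => \sum_k \sum_(l | l != k)
    Num.sqrt (word_mx M w i k) * Num.sqrt (word_mx M w j l))).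
apply: ler_sum => v _.
under [leRHS]eq_bigr => a _ do under eq_bigr => b _ do rewrite mulr_sumr.
under [leRHS]eq_bigr => a _ do rewrite exchange_big /=.
rewrite [leRHS]exchange_big /=; apply: ler_sum => w _.
under [leRHS]eq_bigr => a _ do under eq_bigr => b _ do
  (rewrite mulr_sumr; under eq_bigr => k _ do rewrite mulr_sumr).
under [leRHS]eq_bigr => a _ do rewrite exchange_big /=.
rewrite [leRHS]exchange_big /=; apply: ler_sum => k _.
under [leRHS]eq_bigr => a _ do rewrite exchange_big /=.
rewrite [leRHS]exchange_big /=; apply: ler_sum => l _.
have E c d : Num.sqrt (word_mx M (v ++ w) c d) <=
    \sum_a Num.sqrt (word_mx M v c a) * Num.sqrt (word_mx M w a d).
  rewrite word_mx_cat mxE.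
  under [leRHS]eq_bigr => a _ do rewrite -sqrtrM ?word_mx_ge0 //.
  by apply: sqrt_sum_le => a; rewrite mulr_ge0 ?word_mx_ge0.
apply: (le_trans (ler_pM _ _ (E i k) (E j l))) => //.
rewrite mulr_suml; apply: ler_sum => a _; rewrite mulr_sumr; apply: ler_sum => b _.
by rewrite mulrACA.
Qed.

Lemma overlap_le_affinity t i j :
  overlap t i j <=
  \sum_(w : t.-tuple X) Num.sqrt (state_prob i w) * Num.sqrt (state_prob j w).
Proof.
apply: ler_sum => w _; rewrite !state_probE.
rewrite -!sqrt_sum_single; try by move=> k l; apply: word_mx_unifilar.
rewrite mulr_suml; apply: ler_sum => k _; rewrite mulr_sumr.
by rewrite [leRHS](bigID (fun l => l != k)) /= lerDl sumr_ge0 // => *; rewrite mulr_ge0.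
Qed.

(** The deficit of the Bhattacharyya coefficient is half the squared Hellinger
  distance. *)
Lemma affinityE t i j :
  \sum_(w : t.-tuple X) Num.sqrt (state_prob i w) * Num.sqrt (state_prob j w) =
  1 - 2^-1 * \sum_(w : t.-tuple X)
    (Num.sqrt (state_prob i w) - Num.sqrt (state_prob j w)) ^+ 2.
Proof.
have {1}-> : 1 = 2^-1 * (\sum_(w : t.-tuple X) (state_prob i w + state_prob j w)).
  by rewrite big_split /= !sum_state_prob; field.
rewrite -mulrBr -sumrB mulr_sumr; apply: eq_bigr => w _.
rewrite -{2}(sqr_sqrtr (state_prob_ge0 i w)) -{2}(sqr_sqrtr (state_prob_ge0 j w)).
by field.
Qed.

Lemma overlap_le1 t i j : overlap t i j <= 1.
Proof.
apply: (le_trans (overlap_le_affinity t i j)); rewrite affinityE.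
by rewrite gerBl mulr_ge0 ?invr_ge0 // sumr_ge0 // => w _; rewrite sqr_ge0.
Qed.

Lemma overlap_lt1 t i j (w : t.-tuple X) :
  state_prob i w != state_prob j w -> overlap t i j < 1.
Proof.
move=> ij; apply: (le_lt_trans (overlap_le_affinity t i j)); rewrite affinityE.
rewrite gtrBl mulr_gt0 ?invr_gt0 // (bigD1 w) //= ltr_wpDr ?sumr_ge0 // => [v _|].
  exact: sqr_ge0.
rewrite lt0r sqr_ge0 andbT sqrf_eq0 subr_eq0; apply: contraNN ij => /eqP E.
by rewrite -(sqr_sqrtr (state_prob_ge0 i w)) E sqr_sqrtr ?state_prob_ge0.
Qed.

Hypothesis distM : distinct_states M.

Lemma overlap_uniform_lt1 :
  exists2 n, (0 < n)%N & exists2 c, c < 1 & forall i j, overlap n i j <= c.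
Proof.
have distT (ij : 'I_(nstates M) * 'I_(nstates M)) : exists w : seq X,
    ij.1 != ij.2 -> state_prob ij.1 w != state_prob ij.2 w.
  case: (eqVneq ij.1 ij.2) => [_|/distM[w _ Dw]]; first by exists [::].
  by exists w.
have [W WP] := choice distT.
pose n := (\max_ij size (W ij)).+1.
exists n => //.
have lt1 i j : overlap n i j < 1.
  case: (eqVneq i j) => [->|ij]; first by rewrite overlap_diag ltr01.
  have szn : (size (W (i, j)) <= n)%N by rewrite leqW // (leq_bigmax (i, j)).
  suff [w Dw] : exists w : n.-tuple X, state_prob i w != state_prob j w.
    exact: overlap_lt1 Dw.
  apply: contrapT => /forallNP no.
  have /negP := WP (i, j) ij; apply; apply/eqP => /=.
  apply: (@eq_state_prob_shorter _ (n - size (W (i, j))) i j _ (in_tuple _)).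
  rewrite subnKC // => w; apply/eqP.
  exact/negPn/negP/(no w).
exists (\big[Order.max/0]_(ij : 'I_(nstates M) * 'I_(nstates M)) overlap n ij.1 ij.2).
  by rewrite bigmax_lt.
by move=> i j; rewrite (le_bigmax _ (fun ij : _ * _ => overlap n ij.1 ij.2) (i, j)).
Qed.

(** If n is a length at which all overlaps are at most c < 1, the sum S of the
  overlaps satisfies S <= n + c S, hence S <= n / (1 - c). *)
Lemma overlap_summable :
  exists2 K, 0 <= K & forall T i j, \sum_(0 <= t < T) overlap t i j <= K.
Proof.
have [n n0 [c c1 cP]] := overlap_uniform_lt1.
case: (pselect (exists i : 'I_(nstates M), True)) => [[i0 _]|no]; last first.
  by exists 0 => // T i; case: no; exists i.
have c0 : 0 <= c by apply: le_trans (cP i0 i0); apply: overlap_ge0.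
have c1' : 1 - c > 0 by rewrite subr_gt0.
pose K := n%:R / (1 - c).
have KE : n%:R + c * K = K by rewrite /K; field; rewrite lt0r_neq0.
have K0 : 0 <= K by rewrite divr_ge0 // ltW.
exists K => //; elim=> [|T IHT] i j; first by rewrite big_geq.
(* As n > 0, there is room to pass from T + 1 terms to n + T terms, of which
   the last T are governed by the induction hypothesis. *)
apply: (@le_trans _ _ (\sum_(0 <= t < n + T) overlap t i j)).
  rewrite [leRHS](big_cat_nat (n := T.+1)) //=; last by rewrite -add1n leq_add2r.
  by rewrite lerDl sumr_ge0 // => *; apply: overlap_ge0.
rewrite (big_cat_nat (n := n)) //= ?leq_addr // -KE lerD //.
  apply: (le_trans (ler_sum _ (fun t _ => overlap_le1 t i j))).
  by rewrite sumr_const_nat subn0.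
rewrite -{1}[n]add0n big_addn addKn.
under eq_bigr => t _ do rewrite addnC.
apply: (le_trans (ler_sum _ (fun t _ => overlap_cat n t i j))).
apply: (@le_trans _ _ (overlap n i j * K)); last by rewrite ler_wpM2r.
rewrite exchange_big /= mulr_suml; apply: ler_sum => v _.
rewrite exchange_big /= mulr_suml; apply: ler_sum => a _.
rewrite exchange_big /= mulr_suml (bigID (fun b => b != a)) /=.
rewrite [X in _ + X <= _]big1 ?addr0 => [|b /negPn/eqP ->]; last first.
  by rewrite big1 // => t _; rewrite overlap_diag mulr0.
apply: ler_sum => b ba; rewrite -mulr_sumr ler_wpM2l ?mulr_ge0 //.
Qed.

End Unifilar.
End HMM.
Arguments overlap {R X} M t i j.

(** * The filter and its expected uncertainty *)

Section Stationary.
Context (R : realType) (X : finType) (M : hmm R X) (pi : 'rV[R]_(nstates M)).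
Hypotheses (hmmM : is_hmm M) (piM : stationary_distribution pi).

Lemma stationary_ge0 k : 0 <= pi 0 k.
Proof. by case: piM. Qed.

(** The support of a stationary distribution is closed under edges. *)
Lemma stationary_gt0 : strongly_connected M -> forall k, 0 < pi 0 k.
Proof.
move=> connM k; have [pi0 pi1 piT] := piM.
have [i pii] : exists i, 0 < pi 0 i.
  apply: contrapT => /forallNP no; move: pi1; rewrite big1.
    by move/eqP; rewrite eq_sym oner_eq0.
  by move=> i _; apply/eqP; rewrite eq_le pi0 leNgt andbT; apply/negP/no.
have /connectP[s] := connM i k.
elim: s i pii => [|j s IHs] i pii /=; first by move=> _ ->.
case/andP => /existsP[x Tij] sP; apply: (IHs j) sP.
rewrite -piT mxE (bigD1 i) //= ltr_pwDl //.
  rewrite mulr_gt0 // /total_mx summxE (bigD1 x) //= ltr_pwDl //.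
  by apply: sumr_ge0 => y _; case: hmmM.
apply: sumr_ge0 => l _; rewrite mulr_ge0 // /total_mx summxE.
by apply: sumr_ge0 => y _; case: hmmM.
Qed.

Definition joint (w : seq X) (k : 'I_(nstates M)) : R := (pi *m word_mx M w) 0 k.

Lemma jointE w k : joint w k = \sum_i pi 0 i * word_mx M w i k.
Proof. by rewrite /joint mxE. Qed.

Lemma joint_ge0 w k : 0 <= joint w k.
Proof.
by rewrite jointE sumr_ge0 // => i _; rewrite mulr_ge0 ?stationary_ge0 ?word_mx_ge0.
Qed.

Lemma sum_joint_cons w k : \sum_x joint (x :: w) k = joint w k.
Proof.
have [_ _ piT] := piM; rewrite /joint -[in RHS]piT /total_mx mulmx_sumr mulmx_suml.
by rewrite summxE; apply: eq_bigr => x _; rewrite word_mx_cons mulmxA.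
Qed.

Lemma sum_joint_words t k : \sum_(w : t.-tuple X) joint w k = pi 0 k.
Proof.
elim: t => [|t IHt].
  by rewrite (sum_words0 (joint^~ k)) /joint word_mx_nil mulmx1.
rewrite (sum_words_cons t (joint^~ k)) exchange_big /= -[RHS]IHt.
by apply: eq_bigr => w _; rewrite sum_joint_cons.
Qed.

Lemma sqrt_joint_le w k :
  Num.sqrt (joint w k) <= \sum_i Num.sqrt (word_mx M w i k).
Proof.
rewrite jointE; apply: (le_trans (sqrt_sum_le _)) => [i|].
  by rewrite mulr_ge0 ?stationary_ge0 ?word_mx_ge0.
apply: ler_sum => i _; rewrite ler_wsqrtr // ler_piMl ?word_mx_ge0 //.
have [_ <- _] := piM; rewrite (bigD1 i) //= lerDl sumr_ge0 // => j _.
exact: stationary_ge0.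
Qed.

End Stationary.

Section Beliefs.
Context (R : realType) (X : alphabetType) (M : hmm R X) (pi : 'rV[R]_(nstates M)).
Context (P : probability (biseq X) R).
Hypotheses (hmmM : is_hmm M) (piM : stationary_distribution pi).
Hypothesis genP : forall w, w != [::] -> word_prob P w = l1norm (pi *m word_mx M w).
Local Notation joint := (joint pi).

Lemma word_probE w : word_prob P w = \sum_k joint w k.
Proof.
have [->|w0] := eqVneq w [::]; last first.
  rewrite genP // /l1norm; apply: eq_bigr => k _.
  by rewrite ger0_norm //; apply: joint_ge0.
have [_ pi1 _] := piM; rewrite /word_prob /cylinder /joint word_mx_nil mulmx1 pi1.
rewrite (_ : [set x | _] = setT) ?probability_setT //.
by apply/seteqP; split.
Qed.

Lemma word_prob_ge0 w : 0 <= word_prob P w.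
Proof. by rewrite word_probE sumr_ge0 // => k _; apply: joint_ge0. Qed.

Lemma joint_le_word_prob w k : joint w k <= word_prob P w.
Proof.
rewrite word_probE (bigD1 k) //= lerDl sumr_ge0 // => l _; exact: joint_ge0.
Qed.

Lemma word_prob_cat v w :
  word_prob P (v ++ w) = \sum_k joint v k * state_prob k w.
Proof.
rewrite word_probE /joint word_mx_cat mulmxA.
under eq_bigr => k _ do rewrite mxE.
rewrite exchange_big; apply: eq_bigr => k _ /=.
by rewrite state_probE // mulr_sumr.
Qed.

Lemma sum_word_prob_cons w : \sum_x word_prob P (x :: w) = word_prob P w.
Proof.
under eq_bigr => x _ do rewrite word_probE.
rewrite exchange_big /= word_probE; apply: eq_bigr => k _.
exact: sum_joint_cons.
Qed.

Lemma word_prob_cons_le x w : word_prob P (x :: w) <= word_prob P w.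
Proof.
rewrite -[leRHS]sum_word_prob_cons (bigD1 x) //= lerDl sumr_ge0 // => y _.
exact: word_prob_ge0.
Qed.

(** The filter: the conditional law of the state reached by the machine, given
  that it has just emitted w. *)
Definition belief w k : R := joint w k / word_prob P w.

Lemma word_prob_belief w k : word_prob P w * belief w k = joint w k.
Proof.
have [w0|w0] := eqVneq (word_prob P w) 0; last by rewrite /belief mulrC divfK.
rewrite w0 mul0r; apply/eqP; rewrite eq_le joint_ge0 //= -[leRHS]w0.
exact: joint_le_word_prob.
Qed.

Lemma belief_ge0 w k : 0 <= belief w k.
Proof. by rewrite divr_ge0 ?word_prob_ge0 ?joint_ge0. Qed.

Lemma belief_le1 w k : belief w k <= 1.
Proof.
have [w0|w0] := eqVneq (word_prob P w) 0.
  by rewrite /belief w0 invr0 mulr0.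
by rewrite ler_pdivrMr ?mul1r ?joint_le_word_prob // lt0r w0 word_prob_ge0.
Qed.

Lemma sum_belief w : 0 < word_prob P w -> \sum_k belief w k = 1.
Proof.
by move=> w0; rewrite -mulr_suml -word_probE divff // lt0r_neq0.
Qed.

Lemma cond_probE v w : cond_prob P w v = \sum_k belief v k * state_prob k w.
Proof.
rewrite /cond_prob word_prob_cat mulr_suml; apply: eq_bigr => k _.
by rewrite mulrAC.
Qed.

(** Zero exactly on point masses, when w has positive probability. *)
Definition uncertainty w : R := \sum_k belief w k * (1 - belief w k).

Definition drift x w : R := \sum_k `|belief (x :: w) k - belief w k|.

Lemma uncertainty_ge0 w : 0 <= uncertainty w.
Proof.
by apply: sumr_ge0 => k _; rewrite mulr_ge0 ?belief_ge0 // subr_ge0 belief_le1.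
Qed.

(** For a and b in [0, c] one has a b / c <= sqrt a sqrt b,
  and the square root is subadditive over the initial states. *)
Lemma word_prob_uncertainty_le w :
  word_prob P w * uncertainty w <=
  \sum_i \sum_j \sum_k \sum_(l | l != k)
    Num.sqrt (word_mx M w i k) * Num.sqrt (word_mx M w j l).
Proof.
apply: (@le_trans _ _
  (\sum_k \sum_(l | l != k) Num.sqrt (joint w k) * Num.sqrt (joint w l))).
  rewrite mulr_sumr; apply: ler_sum => k _.
  rewrite mulrA word_prob_belief.
  have [w0|w0] := eqVneq (word_prob P w) 0.
    have -> : joint w k = 0 by rewrite -word_prob_belief w0 mul0r.
    by rewrite mul0r sumr_ge0 // => l _; rewrite mulr_ge0.
  have w_gt0 : 0 < word_prob P w by rewrite lt0r w0 word_prob_ge0.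
  have -> : 1 - belief w k = \sum_(l | l != k) belief w l.
    by rewrite -(sum_belief w_gt0) (bigD1 k) //= [X in X - _]addrC addrK.
  rewrite mulr_sumr; apply: ler_sum => l _.
  set a := Num.sqrt (joint w k); set b := Num.sqrt (joint w l).
  have a0 : 0 <= a := sqrtr_ge0 _.
  have b0 : 0 <= b := sqrtr_ge0 _.
  have aE : a ^+ 2 = joint w k by rewrite sqr_sqrtr // joint_ge0.
  have bE : b ^+ 2 = joint w l by rewrite sqr_sqrtr // joint_ge0.
  have abP : a * b <= word_prob P w.
    rewrite -ler_sqr ?nnegrE ?mulr_ge0 ?(ltW w_gt0) // exprMn aE bE expr2.
    by rewrite ler_pM ?joint_ge0 ?joint_le_word_prob.
  rewrite /belief -aE -bE mulrA ler_pdivrMr // -exprMn expr2.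
  by rewrite ler_wpM2l ?mulr_ge0.
under [leRHS]eq_bigr => i _ do rewrite exchange_big /=.
rewrite [leRHS]exchange_big /=; apply: ler_sum => k _.
under [leRHS]eq_bigr => i _ do rewrite exchange_big /=.
rewrite [leRHS]exchange_big /=; apply: ler_sum => l _.
apply: (le_trans (ler_pM _ _ (sqrt_joint_le hmmM piM w k)
  (sqrt_joint_le hmmM piM w l))) => //.
by rewrite mulr_suml; apply: ler_sum => i _; rewrite mulr_sumr.
Qed.

Lemma sum_uncertainty_le t :
  \sum_(w : t.-tuple X) word_prob P w * uncertainty w <=
  \sum_i \sum_j overlap M t i j.
Proof.
rewrite /overlap; under [leRHS]eq_bigr => i _ do rewrite exchange_big /=.
rewrite [leRHS]exchange_big /=; apply: ler_sum => w _.
exact: word_prob_uncertainty_le.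
Qed.

(** For a and b in [0, 1], |a - b| <= a (1 - b) + b (1 - a). When b is the
  conditional mean of a, as the filter at w is that of the filters at the x :: w,
  the right-hand side has conditional mean 2 b (1 - b). *)
Lemma expected_drift_le w :
  \sum_x word_prob P (x :: w) * drift x w <= 2 * (word_prob P w * uncertainty w).
Proof.
under eq_bigr => x _ do rewrite /drift mulr_sumr.
rewrite exchange_big /= /uncertainty !mulr_sumr; apply: ler_sum => k _.
apply: (@le_trans _ _ (\sum_x (joint (x :: w) k * (1 - belief w k) +
    belief w k * (word_prob P (x :: w) - joint (x :: w) k)))).
  apply: ler_sum => x _; rewrite -word_prob_belief.
  set a := belief _ _; set b := belief _ _; set p := word_prob _ _.
  have -> : p * a * (1 - b) + b * (p - p * a) =
    p * (a * (1 - b) + b * (1 - a)) by ring.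
  rewrite ler_wpM2l ?word_prob_ge0 //.
  have a0 : 0 <= a by apply: belief_ge0.
  have b0 : 0 <= b by apply: belief_ge0.
  have a1 : a <= 1 by apply: belief_le1.
  have b1 : b <= 1 by apply: belief_le1.
  by rewrite ler_norml; apply/andP; split; nra.
rewrite big_split /= -mulr_suml -mulr_sumr sumrB sum_joint_cons //.
rewrite sum_word_prob_cons -word_prob_belief.
by rewrite le_eqVlt; apply/orP; left; apply/eqP; ring.
Qed.

End Beliefs.

(** * Integration along the past *)

Lemma measurable_cvg_to d (T : measurableType d) (R : realType)
    (h : nat -> T -> R) (c : R) :
  (forall n, measurable_fun setT (h n)) ->
  measurable [set p | h ^~ p @ \oo --> c].
Proof.
move=> mh.
rewrite (_ : mkset _ = \bigcap_k \bigcup_m \bigcap_(n in [set n | (m <= n)%N])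
    [set p | `|c - h n p| < k.+1%:R^-1]).
  apply: bigcap_measurable => [|k _]; first by exists 0%N.
  apply: bigcupT_measurable => m; apply: bigcap_measurable => [|n _].
    by exists m => /=.
  rewrite -[X in measurable X]setTI.
  rewrite (_ : [set p | _] = (fun p => `|c - h n p|) @^-1` `]-oo, k.+1%:R^-1[%classic).
    have mcn : measurable_fun setT (fun p => `|c - h n p|).
      by apply: measurableT_comp => //; apply: measurable_funB.
    by apply: mcn => //; apply: measurable_itv.
  by apply/seteqP; split => p /=; rewrite in_itv.
apply/seteqP; split => p /=.
  move=> /cvgrPdist_lt hc k _.
  have /hc[m _ mP] : (0 : R) < k.+1%:R^-1 by rewrite invr_gt0.
  by exists m.
move=> hc; apply/cvgrPdist_lt => e e0.
have [k ke] : exists k, k.+1%:R^-1 < e.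
  exists (Num.truncn e^-1).
  by rewrite invf_plt ?posrE // truncnS_gt.
have [m _ mP] := hc k I.
by exists m => // n /= mn; apply: lt_trans ke; apply: mP.
Qed.

Section PastLaw.
Context (R : realType) (X : alphabetType) (P : probability (biseq X) R).
Hypothesis statP : stationary_process P.
Local Notation mu := (past_law P).

Lemma measurable_cylinder (w : seq X) t : measurable (cylinder w t : set (biseq X)).
Proof.
have [->|/eqP w0] := eqVneq w [::].
  by rewrite (_ : cylinder _ _ = setT) //; apply/seteqP; split.
by apply: sub_sigma_algebra; exists w, t.
Qed.

(** Pasts occupy negative times, whereas word probabilities are read at time 0. *)
Lemma cylinder_law (w : seq X) n : P (cylinder w (- n%:Z)) = (word_prob P w)%:E.
Proof.
rewrite /word_prob fineK; last first.
  by apply: fin_num_measure; apply: measurable_cylinder.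
elim: n => [|n <-]; first by rewrite oppr0.
rewrite -statP; last exact: measurable_cylinder.
congr (P _); apply/seteqP; split => x; rewrite /cylinder /= => wx;
  rewrite -[RHS]wx; apply: eq_mkseq => k; rewrite /bishift; congr (x _); lia.
Qed.

Definition past_cylinder (w : seq X) : set (past X) :=
  [set p | past_word p (size w) = w].

Lemma measurable_past_cylinder w : measurable (past_cylinder w).
Proof.
have [->|/eqP w0] := eqVneq w [::].
  by rewrite (_ : past_cylinder _ = setT) //; apply/seteqP; split.
by apply: sub_sigma_algebra; exists w.
Qed.

Lemma past_law_cylinder w : mu (past_cylinder w) = (word_prob P w)%:E.
Proof.
rewrite -(cylinder_law w (size w)) /past_law /distribution /pushforward.
by congr (P _); apply/seteqP; split => x; rewrite /past_cylinder /cylinder /=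
  past_word_past_of.
Qed.

Lemma past_wordS (p : past X) t : past_word p t.+1 = p t :: past_word p t.
Proof. by rewrite /past_word mkseqS rev_rcons. Qed.

Lemma size_past_word (p : past X) t : size (past_word p t) = t.
Proof. by rewrite size_rev size_mkseq. Qed.

(** Functions of the last t symbols are simple functions, which gives at once their
  measurability and their integral. *)
Lemma fun_past_wordE (g : seq X -> R) t (p : past X) :
  g (past_word p t) = \sum_(w : t.-tuple X) g w * \1_(past_cylinder w) p.
Proof.
have sz : size (past_word p t) == t by rewrite size_past_word.
rewrite (bigD1 (Tuple sz)) //= big1 ?addr0 => [|w wN].
  rewrite indicE mem_set ?mulr1 //=.
  by rewrite /past_cylinder /= size_past_word.
rewrite indicE memNset ?mulr0 //.
rewrite /past_cylinder /= size_tuple => E; move/eqP: wN; apply.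
by apply: val_inj.
Qed.

Lemma measurable_fun_past_word (g : seq X -> R) t :
  measurable_fun setT (fun p : past X => g (past_word p t)).
Proof.
apply: (eq_measurable_fun
    (fun p => \sum_(w : t.-tuple X) g w * \1_(past_cylinder w) p)) => [p _|].
  by rewrite -fun_past_wordE.
apply: measurable_sum => w; apply: measurable_funM => //.
by apply: measurable_indic; apply: measurable_past_cylinder.
Qed.

Lemma integral_past_word (g : seq X -> R) t : (forall w, 0 <= g w) ->
  (\int[mu]_p (g (past_word p t))%:E =
   (\sum_(w : t.-tuple X) g w * word_prob P w)%:E)%E.
Proof.
move=> g0.
under eq_integral do rewrite fun_past_wordE -sumEFin.
rewrite ge0_integral_sum //; last first.
- by move=> w p _; rewrite lee_fin mulr_ge0 // indicE.
- move=> w; apply/measurable_EFinP; apply: measurable_funM => //.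
  by apply: measurable_indic; apply: measurable_past_cylinder.
rewrite -sumEFin; apply: eq_bigr => w _.
under eq_integral do rewrite EFinM.
rewrite ge0_integralZl //.
- rewrite integral_indic //; last exact: measurable_past_cylinder.
  by rewrite setIT EFinM; congr (_ * _)%E; apply: past_law_cylinder.
- apply/measurable_EFinP; apply: measurable_indic.
  exact: measurable_past_cylinder.
- by rewrite lee_fin.
Qed.

Lemma ae_word_prob_gt0 : (forall w, 0 <= word_prob P w) ->
  {ae mu, forall p, forall t, 0 < word_prob P (past_word p t)}.
Proof.
move=> P0; apply: ae_foralln => t.
pose g w : R := (word_prob P w == 0)%:R.
pose N := [set p : past X | word_prob P (past_word p t) = 0].
have mN : measurable N.
  rewrite -[N]setTI.
  have mw := measurable_fun_past_word (word_prob P) t.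
  exact: (mw measurableT [set 0] (measurable_set1 0)).
exists N; split => //.
- transitivity (\int[mu]_p (g (past_word p t))%:E)%E.
    rewrite -[in LHS](setIT N) -(integral_indic mu measurableT mN).
    by apply: eq_integral => p _; rewrite indicE /N /g; congr ((nat_of_bool _)%:R%:E);
      apply/idP/eqP; rewrite inE.
  rewrite integral_past_word ?big1 // => w _.
  by rewrite /g; case: eqP => [->|_]; rewrite ?mulr0 ?mul0r.
- move=> p /=; apply: contra_notP => /eqP w0.
  by rewrite lt0r w0 P0.
Qed.

(** The sum of the series has a finite integral, hence is finite almost
  everywhere. *)
Lemma ae_cvg_series (h : nat -> past X -> R) (C : R) :
  (forall t, measurable_fun setT (h t)) -> (forall t p, 0 <= h t p) ->
  (forall T, \sum_(0 <= t < T) \int[mu]_p (h t p)%:E <= C%:E)%E ->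
  {ae mu, forall p, cvgn (series (h ^~ p))}.
Proof.
move=> mh h0 hC; pose S p : \bar R := (\sum_(t <oo) (h t p)%:E)%E.
have S0 p : (0 <= S p)%E by apply: nneseries_ge0 => t _ _; rewrite lee_fin.
have mS : measurable_fun setT S.
  apply: (ge0_emeasurable_sum (P := xpredT)) => [t p _ _|t _].
    by rewrite lee_fin.
  exact/measurable_EFinP.
have iS : mu.-integrable setT S.
  apply/integrableP; split => //.
  under eq_integral do rewrite gee0_abs //.
  rewrite integral_nneseries // => [|t|t p _]; last 2 first.
  - exact/measurable_EFinP.
  - by rewrite lee_fin.
  apply: (@le_lt_trans _ _ C%:E); last exact: ltry.
  apply: lime_le; last by apply: nearW => T.
  by apply: is_cvg_nneseries => t _ _; apply: integral_ge0 => p _; rewrite lee_fin.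
have := integrable_ae measurableT iS; apply: filterS => p /(_ I) Sp.
by apply: nnseries_is_cvg => //; rewrite ltey_eq Sp.
Qed.

End PastLaw.

(** * Equivalence classes of pasts *)

Lemma cvg_sum_fin (R : realType) (I : finType) (u : I -> nat -> R) (l : I -> R) :
  (forall i, u i @ \oo --> l i) ->
  (fun n => \sum_i u i n) @ \oo --> \sum_i l i.
Proof. by move=> ul; apply: cvg_big => //; apply: add_continuous. Qed.

Section Classes.
Context (R : realType) (X : alphabetType) (P : probability (biseq X) R).
Implicit Types (c : seq X -> R) (F : set (past X)).

(** Classes are indexed here by their predictions rather than by a representative
  past: this makes their measurability and their disjointness immediate. *)
Definition law_class c : set (past X) :=
  [set p | (forall t, 0 < word_prob P (past_word p t)) /\
           (forall w, w != [::] -> cond_prob P w (past_word p t) @[t --> \oo] --> c w)].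

Lemma measurable_law_class c : measurable (law_class c).
Proof.
pose C (w : seq X) := [set p : past X |
  w != [::] -> cond_prob P w (past_word p t) @[t --> \oo] --> c w].
have -> : law_class c =
    (\bigcap_t [set p | 0 < word_prob P (past_word p t)]) `&` \bigcap_w C w.
  apply/seteqP; split=> p [p0 pc]; split.
  - by move=> t _; apply: p0.
  - by move=> w _; apply: pc.
  - by move=> t; apply: p0.
  - by move=> w; apply: pc.
apply: measurableI.
  apply: bigcapT_measurable => t; rewrite -[X in measurable X]setTI.
  have mw := measurable_fun_past_word (word_prob P) t.
  have := mw measurableT `]0, +oo[%classic (measurable_itv _).
  congr measurable; apply/seteqP; split=> p [_] /=; rewrite in_itv /= andbT //.
rewrite -[X in measurable X]setCK setC_bigcap; apply: measurableC.
apply: countable_bigcupT_measurable => // w; apply: measurableC.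
have [->|w0] := eqVneq w [::].
  by rewrite (_ : C _ = setT) //; apply/seteqP; split.
rewrite (_ : C w = [set p | (fun t => cond_prob P w (past_word p t)) @ \oo --> c w]).
  by apply: measurable_cvg_to => t; apply: measurable_fun_past_word.
by apply/seteqP; split=> p; [apply|move=> pc _].
Qed.

Lemma past_prob_law_class c p w : law_class c p -> w != [::] -> past_prob P w p = c w.
Proof. by case=> _ pc /pc; apply: cvg_lim. Qed.

Lemma law_class_eq c c' p : law_class c p -> law_class c' p -> law_class c = law_class c'.
Proof.
move=> cp c'p.
have E w : w != [::] -> c w = c' w.
  by move=> w0; rewrite -(past_prob_law_class cp w0) (past_prob_law_class c'p w0).
by apply/seteqP; split => q [q0 qc]; split=> // w w0; [rewrite -E|rewrite E] => //; apply: qc.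
Qed.

Lemma eps_classesP F : eps_classes P F <-> exists2 c, F = law_class c & F !=set0.
Proof.
split=> [[p rp <-]|[c -> [p cp]]].
  exists (fun w => past_prob P w p); last by exists p; split => // w.
  apply/seteqP; split => q [].
    move=> [q0 qc] pq; split => // w w0.
    by rewrite pq //; apply: qc.
  move=> q0 qc; split; last by move=> w w0; rewrite [RHS](cvg_lim _ (qc w w0)).
  by split=> // w w0; apply/cvg_ex; exists (past_prob P w p); apply: qc.
have [p0 pc] := cp.
exists p; first by split=> // w /pc cw; apply/cvg_ex; exists (c w).
apply/seteqP; split => q.
  move=> [[q0 qc] pq]; split => // w w0.
  by rewrite -(past_prob_law_class cp w0) pq //; apply: qc.
move=> cq; have [q0 qc] := cq; split.
  by split=> // w /qc cw; apply/cvg_ex; exists (c w).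
by move=> w w0; rewrite (past_prob_law_class cp w0) (past_prob_law_class cq w0).
Qed.

Lemma class_prob_law_class c w : w != [::] -> law_class c !=set0 ->
  class_prob P w (law_class c) = c w.
Proof.
move=> w0 [p cp]; apply: get_unique.
  by exists p => //; apply: past_prob_law_class.
by move=> _ [q cq <-]; apply: past_prob_law_class.
Qed.

Lemma delta_h_law_class c c' x : law_class c !=set0 ->
  (forall p, law_class c p -> law_class c' (past_cons p x)) ->
  delta_h P (law_class c) x = law_class c'.
Proof.
move=> [p cp] cc'; apply: get_unique => /=.
  by split=> //; apply/eps_classesP; exists c' => //; exists (past_cons p x); apply: cc'.
move=> F [/eps_classesP[d -> _] cd]; apply: law_class_eq (cd p cp) (cc' p cp).
Qed.

End Classes.

(** * Almost sure synchronization *)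

Section Synchronization.
Context (R : realType) (X : alphabetType) (M : hmm R X) (pi : 'rV[R]_(nstates M)).
Context (P : probability (biseq X) R).
Hypotheses (hM : generator_eps_machine M) (piM : stationary_distribution pi).
Hypotheses (statP : stationary_process P).
Hypothesis genP : forall w, w != [::] -> word_prob P w = l1norm (pi *m word_mx M w).
Local Notation mu := (past_law P).
Local Notation belief := (belief pi P).
Implicit Types (p : past X) (k l : 'I_(nstates M)).

Let hmmM : is_hmm M. Proof. by case: hM. Qed.
Let uniM : unifilar M. Proof. by case: hM. Qed.
Let connM : strongly_connected M. Proof. by case: hM. Qed.
Let distM : distinct_states M. Proof. by case: hM. Qed.

(** Both quantities to be summed along the past, as a function of the longer of
  the two consecutive words that they involve. *)
Definition fluctuation (w : seq X) : R :=
  if w is x :: v then drift pi P x v + uncertainty pi P v else 0.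

Lemma fluctuation_ge0 w : 0 <= fluctuation w.
Proof.
case: w => //= x v; rewrite addr_ge0 ?uncertainty_ge0 //.
by apply: sumr_ge0.
Qed.

Lemma expected_fluctuation_le t :
  \sum_(w : t.+1.-tuple X) fluctuation w * word_prob P w <=
  3 * \sum_i \sum_j overlap M t i j.
Proof.
rewrite (sum_words_cons t (fun w => fluctuation w * word_prob P w)) exchange_big /=.
apply: (@le_trans _ _
    (3 * \sum_(w : t.-tuple X) word_prob P w * uncertainty pi P w)).
  rewrite mulr_sumr; apply: ler_sum => w _.
  under eq_bigr => x _ do rewrite mulrC mulrDr.
  rewrite big_split /= -mulr_suml (sum_word_prob_cons hmmM piM genP).
  have := expected_drift_le hmmM piM genP w; lra.
by rewrite ler_wpM2l //; apply: sum_uncertainty_le.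
Qed.

Lemma ae_cvg_fluctuation :
  {ae mu, forall p, cvgn (series (fun t => fluctuation (past_word p t.+1)))}.
Proof.
have [K K0 KP] := overlap_summable hmmM uniM distM.
pose C := 3 * \sum_(i : 'I_(nstates M)) \sum_(j : 'I_(nstates M)) K.
apply: (ae_cvg_series (C := C)) => [t|t p|T].
- exact: measurable_fun_past_word.
- exact: fluctuation_ge0.
under eq_bigr => t _ do rewrite (integral_past_word statP _ fluctuation_ge0).
rewrite sumEFin lee_fin.
apply: (le_trans (ler_sum _ (fun t _ => expected_fluctuation_le t))).
rewrite -mulr_sumr ler_wpM2l // exchange_big; apply: ler_sum => i _ /=.
by rewrite exchange_big; apply: ler_sum => j _.
Qed.

(** Each coordinate of the filter has bounded variation, and its limit a satisfies
  a (1 - a) = 0; the limits add up to 1, so exactly one of them is 1. *)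
Lemma belief_cvg p :
  (forall t, 0 < word_prob P (past_word p t)) ->
  cvgn (series (fun t => fluctuation (past_word p t.+1))) ->
  exists k, forall l, belief (past_word p t) l @[t --> \oo] --> ((l == k)%:R : R).
Proof.
move=> p0 cvgS.
pose b l t := belief (past_word p t) l.
have bE l : cvgn (b l).
  have dC : cvgn (series (telescope (b l))).
    apply: normed_cvg; apply: series_le_cvg cvgS => [t|t|t] /=.
    - by [].
    - exact: fluctuation_ge0.
    rewrite /telescope past_wordS /= /drift (bigD1 l) //= -addrA.
    rewrite {1}/b past_wordS lerDl addr_ge0 ?uncertainty_ge0 //.
    exact: sumr_ge0.
  have -> : b l = fun t => b l 0%N + series (telescope (b l)) t.
    by apply/funext => t; rewrite -eq_sum_telescope.
  by apply: is_cvgD => //; apply: is_cvg_cst.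
have /cvg_series_cvg_0 fluct0 := cvgS.
pose L l := limn (b l).
have bL l : b l @ \oo --> L l by apply: bE.
have L01 l : L l * (1 - L l) = 0.
  have c1 : (fun t => b l t * (1 - b l t)) @ \oo --> L l * (1 - L l).
    by apply: cvgM => //; apply: cvgB => //; apply: cvg_cst.
  have c2 : (fun t => b l t * (1 - b l t)) @ \oo --> (0 : R).
    apply: squeeze_cvgr (cvg_cst 0) fluct0; apply: nearW => t.
    have t0 k : 0 <= b k t * (1 - b k t).
      by rewrite mulr_ge0 ?subr_ge0 ?belief_ge0 ?belief_le1.
    rewrite t0 /= past_wordS /= -[leLHS]add0r lerD ?sumr_ge0 //.
    rewrite /uncertainty (bigD1 l) //= lerDl sumr_ge0 // => j _; exact: t0.
  by apply: cvg_unique c1 c2.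
have L1 : \sum_l L l = 1.
  have c1 : (fun t => \sum_l b l t) @ \oo --> \sum_l L l by apply: cvg_sum_fin.
  have c2 : (fun t => \sum_l b l t) @ \oo --> (1 : R).
    under eq_fun => t do rewrite (sum_belief hmmM piM genP (p0 t)).
    exact: cvg_cst.
  by apply: cvg_unique c1 c2.
have L0 l : 0 <= L l.
  by apply: limr_ge => //; apply: nearW => t; apply: belief_ge0.
have [k Lk] : exists k, L k != 0.
  apply: contrapT => /forallNP no; move/eqP: L1; rewrite big1 1?eq_sym ?oner_eq0 //.
  by move=> l _; apply/eqP/negPn/negP/no.
have Lk1 : L k = 1.
  by have /eqP := L01 k; rewrite mulf_eq0 (negPf Lk) subr_eq0 => /eqP.
exists k => l; suff <- : L l = (l == k)%:R by apply: bL.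
have [-> //|lk] := eqVneq l k.
apply/eqP; rewrite mulr0n eq_le L0 andbT.
move: L1; rewrite (bigD1 k) //= (bigD1 l) //= Lk1 => /eqP.
rewrite -[eqbRHS]addr0 (inj_eq (addrI _)) => /eqP <-.
by rewrite lerDl sumr_ge0.
Qed.

Definition state_class k : set (past X) := law_class P (state_prob k).

Lemma state_class_disjoint p k l : state_class k p -> state_class l p -> k = l.
Proof.
move=> kp lp; apply/eqP; apply: contraT => /distM[w w0].
by rewrite -(past_prob_law_class kp w0) (past_prob_law_class lp w0) eqxx.
Qed.

Lemma belief_cvg_state_class p k :
  (forall t, 0 < word_prob P (past_word p t)) ->
  (forall l, belief (past_word p t) l @[t --> \oo] --> ((l == k)%:R : R)) ->
  state_class k p.
Proof.
move=> p0 bk; split => // w _.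
have -> : state_prob k w = \sum_l (l == k)%:R * state_prob l w.
  rewrite (bigD1 k) //= eqxx mul1r big1 ?addr0 // => l /negPf ->.
  by rewrite mul0r.
under eq_fun => t do rewrite (cond_probE hmmM piM genP).
by apply: cvg_sum_fin => l; apply: cvgM => //; apply: cvg_cst.
Qed.

Lemma ae_synchronized : {ae mu, forall p, exists2 k, state_class k p &
  forall l, belief (past_word p t) l @[t --> \oo] --> ((l == k)%:R : R)}.
Proof.
have := ae_word_prob_gt0 statP (word_prob_ge0 hmmM piM genP).
apply: filterS2 ae_cvg_fluctuation => p p1 p0.
have [k bk] := belief_cvg p0 p1.
by exists k => //; apply: belief_cvg_state_class.
Qed.

(** The filter at k has mean pi(k) at all times, and it converges almost surely to
  the indicator of the class of k. *)
Lemma measure_state_class k : mu (state_class k) = (pi 0 k)%:E.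
Proof.
pose f_ t p : \bar R := (belief (past_word p t) k)%:E.
have [|||||_ _] := @dominated_convergence _ _ _ mu setT measurableT f_
  (fun p => (\1_(state_class k) p)%:E) (cst 1%E).
- move=> t; apply/measurable_EFinP.
  exact: (measurable_fun_past_word (belief^~ k)).
- by apply/measurable_EFinP/measurable_indic; apply: measurable_law_class.
- apply: filterS ae_synchronized => p [l lp bl] _.
  apply: cvg_EFin; first exact: nearW.
  rewrite indicE (_ : (p \in _) = (k == l)); first exact: bl.
  apply/idP/eqP => [|->]; rewrite inE // => kp.
  exact: state_class_disjoint kp lp.
- by apply: finite_measure_integrable_cst.
- apply: nearW => p t _ /=; rewrite lee_fin ger0_norm; first exact: belief_le1.
  exact: belief_ge0.
rewrite integral_indic //; last exact: measurable_law_class.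
rewrite setIT => c1.
have c2 : (fun t => \int[mu]_p f_ t p)%E @ \oo --> (pi 0 k)%:E.
  rewrite (_ : (fun t => _) = cst (pi 0 k)%:E); first exact: cvg_cst.
  apply/funext => t; rewrite (integral_past_word statP _ (belief_ge0 hmmM piM genP ^~ k)).
  rewrite -(sum_joint_words piM t) //; congr EFin; apply: eq_bigr => w _.
  by rewrite mulrC word_prob_belief.
exact: cvg_unique c1 c2.
Qed.

Lemma state_class_neq0 k : state_class k !=set0.
Proof.
apply/set0P; apply/eqP => k0.
have := measure_state_class k; rewrite k0 measure0 => /esym/eqP.
by rewrite eqe gt_eqF // (stationary_gt0 hmmM piM connM).
Qed.

Lemma past_word_cons p x t : past_word (past_cons p x) t.+1 = past_word p t ++ [:: x].
Proof.
rewrite /past_word /mkseq /= rev_cons -cats1; congr (rev _ ++ _).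
by rewrite -[1%N]addn0 iotaDl -map_comp.
Qed.

(** P_k(x w) / P_k(x) = P_l(w), because l is the only state that k can reach by
  emitting x. *)
Lemma state_class_past_cons k l x p : 0 < trans M x k l ->
  state_class k p -> state_class l (past_cons p x).
Proof.
move=> Tkl [p0 pk].
have kx w : state_prob k (x :: w) = trans M x k l * state_prob l w.
  rewrite -cat1s (state_prob_cat hmmM) word_mx_seq1 (bigD1 l) //= big1 ?addr0 // => j jl.
  have [->|Tkj] := eqVneq (trans M x k j) 0; first by rewrite mul0r.
  by rewrite (trans_unifilar hmmM uniM Tkj (lt0r_neq0 Tkl)) eqxx in jl.
have kx1 : state_prob k [:: x] = trans M x k l.
  rewrite kx (state_probE hmmM) word_mx_nil (bigD1 l) //= big1 => [|j jl].
    by rewrite mxE eqxx addr0 mulr1.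
  by rewrite mxE eq_sym (negPf jl).
have px := pk [:: x] isT; rewrite kx1 in px.
have q0 t : 0 < word_prob P (past_word (past_cons p x) t).
  (* The past p x has positive probability at large times since P(x | p^t) tends
     to a positive limit; at smaller times its probability is even larger. *)
  have [n _ nP] := cvgr_gt _ px _ Tkl.
  have : 0 < word_prob P (past_word (past_cons p x) (t + n).+1).
    rewrite past_word_cons.
    have := nP _ (leq_addl t n); rewrite /cond_prob /=.
    by rewrite pmulr_lgt0 // invr_gt0.
  rewrite -addnS; elim: n.+1 => [|m IHm]; first by rewrite addn0.
  rewrite addnS past_wordS => q0; apply: IHm; apply: lt_le_trans q0 _.
  exact: (word_prob_cons_le hmmM piM genP).
split => // w w0.
rewrite -cvg_shiftS /=.
have -> : (fun t => cond_prob P w (past_word (past_cons p x) t.+1)) =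
    (fun t => cond_prob P (x :: w) (past_word p t) / cond_prob P [:: x] (past_word p t)).
  apply/funext => t; have := q0 t.+1; rewrite /cond_prob past_word_cons => qt.
  rewrite -catA /=; have pt := p0 t.
  by field; rewrite !lt0r_neq0.
have -> : state_prob l w = state_prob k (x :: w) / trans M x k l.
  by rewrite kx; field; apply: lt0r_neq0.
apply: cvgM; first exact: pk.
by apply: cvgV => //; apply: lt0r_neq0.
Qed.

(** A class other than those of the states avoids almost every past. *)
Lemma positive_class_state F : eps_classes P F -> (0 < mu F)%E ->
  exists k, F = state_class k.
Proof.
move=> /eps_classesP[c -> _] F0.
apply: contrapT => /forallNP no.
have [N [mN N0 NP]] := ae_synchronized.
suff FN : law_class P c `<=` N.
  by move: F0; rewrite (subset_measure0 (measurable_law_class P c) mN FN N0) ltxx.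
move=> p cp; apply: NP => -[k kp _]; apply: (no k).
exact: law_class_eq cp kp.
Qed.

End Synchronization.

(** * Identification of the history machine *)

Section Isomorphism.
Context (R : realType) (X : alphabetType) (M : hmm R X) (pi : 'rV[R]_(nstates M)).
Context (P : probability (biseq X) R).
Hypotheses (hM : generator_eps_machine M) (piM : stationary_distribution pi).
Hypotheses (statP : stationary_process P).
Hypothesis genP : forall w, w != [::] -> word_prob P w = l1norm (pi *m word_mx M w).
Implicit Types (k l : 'I_(nstates M)).
Local Notation state_class := (@state_class R X M P).

Let hmmM : is_hmm M. Proof. by case: hM. Qed.
Let uniM : unifilar M. Proof. by case: hM. Qed.
Let connM : strongly_connected M. Proof. by case: hM. Qed.

Lemma state_class_injective k l : state_class k = state_class l -> k = l.
Proof.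
move=> kl; have [p kp] := state_class_neq0 hM piM statP genP k.
by apply: (state_class_disjoint hM kp); rewrite -kl.
Qed.

Lemma positive_state_classes : positive_classes P state_class.
Proof.
have nz := state_class_neq0 hM piM statP genP.
have muE := measure_state_class hM piM statP genP.
split=> [k l|k|k|].
- exact: state_class_injective.
- by apply/eps_classesP; exists (state_prob k).
- by rewrite muE lte_fin (stationary_gt0 hmmM piM connM).
- under eq_bigr do rewrite muE.
  by rewrite sumEFin; case: piM => _ -> _.
Qed.

(** A missing state would leave out the positive mass pi(k) from a total of 1. *)
Lemma positive_classes_states N (E : 'I_N -> set (past X)) :
  positive_classes P E ->
  exists2 f : 'I_N -> 'I_(nstates M), bijective f &
    forall i, E i = state_class (f i).
Proof.
case=> injE epsE E0 E1.
have Estate i := positive_class_state hM piM statP genP (epsE i) (E0 i).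
have [f fE] := choice Estate.
exists f => //.
have injf : injective f by move=> i j fij; apply: injE; rewrite !fE fij.
apply: inj_card_bij => //; rewrite -(card_codom injf).
apply: subset_leq_card; apply/fintype.subsetP => k _; apply: contraT => kf.
have pi0 := stationary_gt0 hmmM piM connM.
have : \sum_i pi 0 (f i) = 1.
  apply: EFin_inj; rewrite -[RHS]E1 -sumEFin; apply: eq_bigr => i _.
  by rewrite fE (measure_state_class hM piM statP genP).
have [_ pi1 _] := piM.
rewrite -(big_image _ _ _ _ (fun l => pi 0 l)) big_uniq /=; last first.
  by rewrite map_inj_uniq ?enum_uniq.
rewrite -pi1 [RHS](bigID (mem (codom f))) /= => /eqP.
rewrite -[eqbLHS]addr0 (inj_eq (addrI _)) (bigD1 k) //= lt_eqF //.
by rewrite ltr_pwDl // sumr_ge0 // => l _; apply: ltW.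
Qed.

Lemma history_machine_trans N (E : 'I_N -> set (past X))
    (f : 'I_N -> 'I_(nstates M)) x i j :
  (forall i, E i = state_class (f i)) ->
  trans (history_machine P E) x i j = trans M x (f i) (f j).
Proof.
move=> fE; rewrite mxE.
have nz k := state_class_neq0 hM piM statP genP k.
have Tge0 k l : 0 <= trans M x k l by case: hmmM.
have cpE : class_prob P [:: x] (E i) = \sum_l trans M x (f i) l.
  rewrite fE class_prob_law_class //; last exact: nz.
  by rewrite state_probE // word_mx_seq1.
have [l Tl|T0] := pickP (fun l => trans M x (f i) l != 0); last first.
  have {}T0 l : trans M x (f i) l = 0 by apply/eqP; have /negbFE := T0 l.
  by rewrite cpE big1 ?ltxx ?T0.
have Tl0 : 0 < trans M x (f i) l by rewrite lt0r Tl Tge0.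
have T0 m : m != l -> trans M x (f i) m = 0.
  move=> ml; apply/eqP; apply: contraNT ml => Tm.
  by apply/eqP/(trans_unifilar hmmM uniM Tm Tl).
rewrite cpE (bigD1 l) //= big1 ?addr0 // Tl0 /=.
have -> : delta_h P (E i) x = state_class l.
  rewrite fE; apply: delta_h_law_class; first exact: nz.
  by move=> p; apply: (state_class_past_cons hM piM genP).
case: asboolP => [lj|lj].
  by congr (trans M x _ _); apply: state_class_injective; rewrite lj fE.
rewrite T0 //; apply/eqP => jl; apply: lj; rewrite fE jl //.
Qed.

End Isomorphism.

Theorem theorem1 (R : realType) (X : alphabetType) (M : hmm R X)
    (P : probability (biseq X) R) (hM : generator_eps_machine M)
    (hP : generated_process M P) :
  finitely_characterized P /\
  (forall (N : nat) (E : 'I_N -> set (past X)), positive_classes P E ->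
     is_hmm (history_machine P E) /\
     hmm_isomorphic (history_machine P E) M).
Proof.
have [statP _ [pi piM genP]] := hP.
split.
  exists (nstates M), (@state_class R X M P).
  exact: (positive_state_classes hM piM statP genP).
move=> N E posE.
have [f bijf fE] := positive_classes_states hM piM statP genP posE.
have TE x i j : trans (history_machine P E) x i j = trans M x (f i) (f j).
  exact: (history_machine_trans hM piM statP genP x i j fE).
have [T0 T1] : is_hmm M by case: hM.
split; last by exists f => // i x p j; rewrite /edge TE.
split=> [x i j|i]; first by rewrite TE.
rewrite -[RHS](T1 (f i)) [RHS](reindex f) /=; last exact: onW_bij.
apply: eq_bigr => j _; rewrite /total_mx !summxE.
by apply: eq_bigr => x _; rewrite TE.
Qed.
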